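(* Let $J$ be a general abelian surface, let $A=J\times J$, and let $(A,K,\omega_K)$ be a polarized abelian fourfold of Weil type, with imaginary quadratic field $K\subset\operatorname{End}_{\mathbf{Q}}(A)$. Then the discriminant of $(A,K,\omega_K)$ in $\mathbf{Q}^\times/\operatorname{Nm}(K^\times)$ is trivial.
   Context: ''General'' means that the Hodge group of $H^1(J,\mathbf{Q})$ is the full symplectic group $\mathrm{Sp}_4$ of a polarization; in particular $\operatorname{End}_{\mathbf{Q}}(J)=\operatorname{End}(J)\otimes\mathbf{Q}=\mathbf{Q}$, $\dim B^1(J)=1$ and $\operatorname{End}_{\mathbf{Q}}(A)=M_2(\mathbf{Q})$. Here $B^1(X)=H^2(X,\mathbf{Q})\cap H^{1,1}(X)$. Let $K=\mathbf{Q}(\sqrt{-d})$, $d\in\mathbf{Z}_{>0}$, be an imaginary quadratic field. An abelian variety of Weil type is a pair $(A,K)$ with $K\hookrightarrow\operatorname{End}_{\mathbf{Q}}(A)$ a subalgebra such that for all $k\in K$ the eigenvalues $k,\bar k$ of $k$ on $T_0A$ have the same multiplicity. A polarized abelian variety of Weil type $(A,K,\omega_K)$ has in addition a polarization $\omega_K\in B^1(A)$ such that $k^*\omega_K=\operatorname{Nm}(k)\omega_K$ for all $k\in K$, where $\operatorname{Nm}(k)=k\bar k$. Discriminant: let $E$ be the $\mathbf{Q}$-bilinear alternating form on $H_1(A,\mathbf{Q})$ defined by $\omega_K$, so $E(kx,ky)=\operatorname{Nm}(k)E(x,y)$. Then $H_1(A,\mathbf{Q})$ is a $K$-vector space and $E$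 defines a $K$-valued Hermitian form $$H(x,y):=E\bigl(x,(\sqrt{-d})_*y\bigr)+\sqrt{-d}\,E(x,y)$$ on it. If $\Psi$ is the Hermitian matrix of $H$ with respect to some $K$-basis of $H_1(A,\mathbf{Q})$, then $\det(\Psi)\in\mathbf{Q}^\times$ and its class in $\mathbf{Q}^\times/\operatorname{Nm}(K^\times)$ is independent of the basis; this class is the discriminant of $(A,K,\omega_K)$. *)

(* Defs.v *)
From HB Require Import structures.
From mathcomp Require Import all_boot all_order all_algebra all_field.
From mathcomp Require Import complex mpoly.
From mathcomp Require Import classical_sets reals.

Set Implicit Arguments.
Unset Strict Implicit.
Unset Printing Implicit Defensive.

Import GRing.Theory Num.Theory.
Local Open Scope ring_scope.
Local Open Scope classical_set_scope.

(* A complex torus of dimension g is given by a period matrix P : 'M_(g, n):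
   it is X = C^g / P Z^n.  Thus T_0 X = C^g, H_1(X, Q) = 'cV[rat]_n, and
   H^1(X, Q) = 'rV[rat]_n is the dual of H_1(X, Q).  An element of H^2(X, Q),
   i.e. an alternating form on H_1(X, Q), is the matrix E of the form
   (x, y) |-> x^T E y. *)

Section AbelianVarieties.
Variable R : realType.
Local Notation C := R[i].
Local Notation toC := (map_mx (real_complex R)).
Local Notation ratC := (map_mx (@ratr C)).
Local Notation conjmx := (map_mx (@Num.conj C)).

(* The columns of P form an R-basis of C^g, i.e. P Z^n is a lattice of full
   rank; this forces n = 2g. *)
Definition period_matrix (g n : nat) (P : 'M[C]_(g, n)) : Prop :=
  bijective (fun x : 'cV[R]_n => P *m toC x).

(* Inside H^1(X, C) = 'rV[C]_n, H^{1,0} is the row space of P, H^{0,1} is the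
   row space of its conjugate, and H^{1,1} is spanned by the
   u^T v - v^T u with u in H^{1,0} and v in H^{0,1}. *)
Definition H11 (g n : nat) (P : 'M[C]_(g, n)) : set 'M[C]_n :=
  [set F | exists Y : 'M[C]_g,
     F = P^T *m Y *m conjmx P - (P^T *m Y *m conjmx P)^T].

Definition B1 (g n : nat) (P : 'M[C]_(g, n)) : set 'M[rat]_n :=
  [set E | E^T = - E /\ H11 P (ratC E)].

(* The second condition is E(x, i x) > 0 for all x <> 0 in H_1(X, R), which is
   identified with T_0 X by P. *)
Definition polarization (g n : nat) (P : 'M[C]_(g, n)) (E : 'M[rat]_n) : Prop :=
  B1 P E /\
  forall x y : 'cV[R]_n, x != 0 -> P *m toC y = 'i *: (P *m toC x) ->
    0 < (x^T *m map_mx (@ratr R) E *m y) 0 0.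

Definition abelian_variety (g n : nat) (P : 'M[C]_(g, n)) : Prop :=
  period_matrix P /\ exists E, polarization P E.

Definition product_period (g n g' n' : nat)
    (P : 'M[C]_(g, n)) (P' : 'M[C]_(g', n')) : 'M[C]_(g + g', n + n') :=
  block_mx P 0 0 P'.

(* T is the analytic representation (action on T_0 X) of the element of
   End_Q(X) whose rational representation (action on H_1(X, Q)) is M. *)
Definition analytic_rep (g n : nat) (P : 'M[C]_(g, n))
    (M : 'M[rat]_n) (T : 'M[C]_g) : Prop :=
  T *m P = P *m ratC M.

Definition EndQ (g n : nat) (P : 'M[C]_(g, n)) : set 'M[rat]_n :=
  [set M | exists T, analytic_rep P M T].

(* GL(H^1(X, C)) consists of the invertible g : 'M[C]_n, acting on row vectors
   by v |-> v *m g; the induced action on H^2 is E |-> g^T *m E *m g. *)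

(* An algebraic subgroup over Q of GL_n is represented by its set of complex
   points, which determines it in characteristic 0. *)
Definition Q_algebraic_subgroup (n : nat) (G : set 'M[C]_n) : Prop :=
  [/\ exists S : set {mpoly rat[n * n]},
        G = [set g | g \in unitmx /\
               forall p, S p -> mmap (@ratr C) (fun k => mxvec g 0 k) p = 0],
      G 1%:M,
      forall g h, G g -> G h -> G (g *m h) &
      forall g, G g -> G (invmx g)].

(* The image of h : U(1) -> GL(H^1(X, R)); h(z) acts on H^{p,q} as
   z^p zbar^q. *)
Definition hodge_circle (g n : nat) (P : 'M[C]_(g, n)) : set 'M[C]_n :=
  [set h | exists z : C, [/\ `|z| = 1, P *m h = z *: P &
                             conjmx P *m h = z^* *: conjmx P]].

(* The smallest algebraic subgroup over Q containing h(U(1)). *)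
Definition hodge_group (g n : nat) (P : 'M[C]_(g, n)) : set 'M[C]_n :=
  [set h | forall G, Q_algebraic_subgroup G -> hodge_circle P `<=` G -> G h].

Definition symplectic_group (n : nat) (E : 'M[rat]_n) : set 'M[C]_n :=
  [set g | g \in unitmx /\ g^T *m ratC E *m g = ratC E].

Definition general_abelian_surface (P : 'M[C]_(2, 4)) : Prop :=
  abelian_variety P /\
  exists2 E, polarization P E & hodge_group P = symplectic_group E.

End AbelianVarieties.

(* K = Q(s) with s = sqrt(-d). *)
Definition imaginary_quadratic (K : fieldExtType rat) (d : nat) (s : K) : Prop :=
  [/\ (0 < d)%N, \dim {:K} = 2%N & s ^+ 2 = - d%:R].

Section WeilType.
Variables (R : realType) (K : fieldExtType rat).
Local Notation C := R[i].

(* The embedding e of K in the complex numbers makes sense of complex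
   conjugation on K, so that Nm k = k kbar. *)
Variable e : {rmorphism K -> C}.

Definition Nm (k : K) : C := e k * (e k)^*.

(* Nm(K^x), as a subset of Q^x. *)
Definition NmK : set rat :=
  [set q | exists2 k : K, k != 0 & ratr q = Nm k].

Definition weil_type (g n : nat) (P : 'M[C]_(g, n))
    (iota : {rmorphism K -> 'M[rat]_n}) : Prop :=
  [/\ abelian_variety P,
      forall k, EndQ P (iota k) &
      forall k T, analytic_rep P (iota k) T ->
        mup (e k) (char_poly T) = mup (e k)^* (char_poly T)].

Definition polarized_weil_type (g n : nat) (P : 'M[C]_(g, n))
    (iota : {rmorphism K -> 'M[rat]_n}) (E : 'M[rat]_n) : Prop :=
  [/\ weil_type P iota, polarization P E &
      forall k, map_mx (@ratr C) ((iota k)^T *m E *m iota k) =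
                Nm k *: map_mx (@ratr C) E].

End WeilType.

Section Discriminant.
Variables (R : realType) (K : fieldExtType rat) (e : {rmorphism K -> R[i]}).
Variables (n : nat) (iota : {rmorphism K -> 'M[rat]_n}) (E : 'M[rat]_n).

(* K acts on H_1(X, Q) through iota. *)
Definition K_basis (m : nat) (b : 'I_m -> 'cV[rat]_n) : Prop :=
  bijective (fun c : 'rV[K]_m => \sum_j iota (c 0 j) *m b j).

Definition bilin (x y : 'cV[rat]_n) : rat := (x^T *m E *m y) 0 0.

Definition hermitian (s : K) (x y : 'cV[rat]_n) : K :=
  ratr (bilin x (iota s *m y)) + s * ratr (bilin x y).

Definition hermitian_matrix (s : K) (m : nat) (b : 'I_m -> 'cV[rat]_n)
  : 'M[K]_m := \matrix_(j, l) hermitian s (b j) (b l).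

(* A class in Q^x / Nm(K^x) is a coset, i.e. a subset of Q^x.  The discriminant
   is the coset of those q such that det(Psi) is in q Nm(K^x) for the Hermitian
   matrix Psi in every K-basis. *)
Definition discriminant (s : K) : set rat :=
  [set q | q != 0 /\ forall m (b : 'I_m -> 'cV[rat]_n), K_basis b ->
     exists2 r, NmK e r & \det (hermitian_matrix s b) = ratr (q * r)].

End Discriminant.

(* Main.v *)
Require Import Defs.
From mathcomp Require Import all_boot all_order all_algebra all_field.
From mathcomp Require Import complex mpoly.
From mathcomp Require Import classical_sets reals.
From mathcomp Require Import ring.

(** The idea is that everything about A = J x J comes from 2 x 2 matrices.

    Since the Hodge group of J is the full symplectic group of a polarization
    E, a rational matrix that commutes with the circle h(U(1)) commutes with
    Sp(E) ([centralizer_Q_algebraic]: its centralizer is an algebraic group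
    over Q), in particular with the transvections x |-> x + E(v, x) v, and so
    has every vector as an eigenvector: it is a scalar
    ([hodge_centralizer_scalar]).  For an endomorphism of J this gives
    End_Q(J) = Q.  For a rational form F of type (1,1), applied to E^-1 F, it
    gives that F is a multiple of E.  Cutting into blocks,
    H_1(A, Q) = Q^2 (x) H_1(J, Q), where K acts on Q^2 only, and
    omega_K = L (x) E for some 2 x 2 matrix L.

    Let v be the first basis vector of Q^2.  As s = sqrt(-d) has no rational
    eigenvalue, v spans Q^2 over K, so that the v (x) f_j, with f_j the
    standard basis of H_1(J, Q), form a K-basis of H_1(A, Q)
    ([block_K_basis]).  The form (x, y) |-> omega_K(x, s y) is symmetric;
    on v (x) H_1(J, Q) it is also a multiple of the alternating form E, hence
    vanishes there.  So the Hermitian matrix in this basis is s l E, where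
    l = L(v, v) is nonzero by positivity ([hermitian_matrix_block]).  Its
    determinant s^4 l^4 det(E) = (d l^2 Pf(E))^2 is a nonzero rational square,
    hence a norm from K, and a change of K-basis multiplies it by a norm
    ([hermitian_matrix_change]). *)

Set Implicit Arguments.
Unset Strict Implicit.
Unset Printing Implicit Defensive.

Import Order.TTheory GRing.Theory Num.Theory.
Local Open Scope ring_scope.

(** * Linear algebra *)

Lemma eigen_all_scalar_mx (F : fieldType) (n : nat) (M : 'M[F]_n) :
  (forall v : 'cV_n, exists c, M *m v = c *: v) -> exists c, M = c%:M.
Proof.
case: n M => [|n] M eigM; first by exists 0; rewrite [M]flatmx0 [RHS]flatmx0.
pose d (i : 'I_n.+1) : 'cV[F]_n.+1 := delta_mx i 0.
have colM i : M *m d i = M i i *: d i.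
  have [c Mc] := eigM (d i).
  have := congr1 (fun A : 'cV_n.+1 => A i 0) Mc.
  by rewrite -colE !mxE !eqxx mulr1 colE => ->.
exists (M 0 0); apply/matrixP => i j.
have -> : M i j = (M *m d j) i 0 by rewrite -colE mxE.
rewrite colM !mxE eqxx andbT -mulr_natr; case: eqP => _; last first.
  by rewrite !mulr0.
rewrite !mulr1; have [->//|j0] := eqVneq j 0.
have [c] := eigM (d j + d 0); rewrite mulmxDr !colM => Mc.
have := congr1 (fun A : 'cV_n.+1 => A j 0) Mc.
have := congr1 (fun A : 'cV_n.+1 => A 0 0) Mc.
rewrite !mxE !eqxx (negPf j0) eq_sym (negPf j0) /=.
by rewrite !(mulr0, mulr1, addr0, add0r) => -> ->.
Qed.

(** The square root is the Pfaffian. *)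
Lemma det_alternating4 (F : comNzRingType) (E : 'M[F]_4) :
  (forall i, E i i = 0) -> E^T = - E -> exists q, \det E = q ^+ 2.
Proof.
move=> E0 /matrixP ET.
have Eji i j : E j i = - E i j by move: (ET i j); rewrite !mxE.
(* [f] reads the entries of [E] at natural numbers, so that all indices
   produced by the Laplace expansion reduce to numerals *)
pose f (a b : nat) : F := E (inord a) (inord b).
have Ef i j : E i j = f i j by rewrite /f !inord_val.
have f0 a : f a a = 0 by rewrite /f E0.
have fC a b : f b a = - f a b by rewrite /f Eji.
exists (f 0%N 1%N * f 2%N 3%N - f 0%N 2%N * f 1%N 3%N + f 0%N 3%N * f 1%N 2%N).
rewrite (expand_det_row _ ord0) !big_ord_recl !big_ord0 /cofactor.
rewrite !(@expand_det_row _ 3 _ ord0) !big_ord_recl !big_ord0 /cofactor.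
rewrite !(@expand_det_row _ 2 _ ord0) !big_ord_recl !big_ord0 /cofactor.
rewrite !det_mx11 !mxE !Ef /= /bump /= !(addn0, add0n, add1n).
rewrite !f0 !(mul0r, mulr0, add0r, addr0).
rewrite (fC 0%N 1%N) (fC 0%N 2%N) (fC 0%N 3%N) (fC 1%N 2%N) (fC 1%N 3%N).
rewrite (fC 2%N 3%N) /=.
ring.
Qed.

(** * The Hodge group and its centralizer *)

Section HodgeTheory.
Variable R : realType.
Local Notation C := R[i].
Local Notation toC := (map_mx (real_complex R)).
Local Notation ratC := (map_mx (@ratr C)).
Local Notation conjmx := (map_mx (@Num.conj C)).

Lemma centralizer_Q_algebraic n (M : 'M[rat]_n) :
  Q_algebraic_subgroup
    [set g : 'M[C]_n | g \in unitmx /\ g *m ratC M = ratC M *m g]%classic.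
Proof.
split.
(* [pol i j] is the (i, j) entry of g M - M g, a linear form in g *)
- pose pol i j : {mpoly rat[n * n]} :=
    \sum_k M k j *: 'X_(mxvec_index i k) - \sum_k M i k *: 'X_(mxvec_index k j).
  have polE (g : 'M[C]_n) i j :
      mmap (@ratr C) (fun k => mxvec g 0 k) (pol i j) =
      (g *m ratC M - ratC M *m g) i j.
    rewrite /pol mmapB !(raddf_sum (mmap _ _)) /= !mxE.
    congr (_ - _); apply: eq_bigr => k _.
      by rewrite mmapZ /= mmapX mmap1U mxvecE mxE mulrC.
    by rewrite mmapZ /= mmapX mmap1U mxvecE mxE.
  exists [set p | exists i j, p = pol i j]%classic.
  apply/seteqP; split=> g /= [gU gM]; split=> //.
    by move=> p [i [j ->]]; rewrite polE gM subrr mxE.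
  apply/eqP; rewrite -subr_eq0; apply/eqP/matrixP => i j.
  by rewrite -polE mxE gM //; exists i, j.
- by rewrite /= unitmx1 mul1mx mulmx1.
- move=> g h [gU gM] [hU hM]; split; first by rewrite unitmx_mul gU.
  by rewrite -mulmxA hM !mulmxA gM.
- move=> g [gU gM]; split; first by rewrite unitmx_inv.
  by apply: (can_inj (mulKmx gU)); rewrite mulKVmx // mulmxA gM mulmxK.
Qed.

Lemma conj_ratr (x : rat) : (ratr x : C)^* = ratr x.
Proof. exact: (fmorph_eq_rat (Num.conj \o @ratr C)). Qed.

Lemma conjmx_ratC m n (M : 'M[rat]_(m, n)) : conjmx (ratC M) = ratC M.
Proof. by apply/matrixP => i j; rewrite !mxE conj_ratr. Qed.

Lemma conjmxK m n (X : 'M[C]_(m, n)) : conjmx (conjmx X) = X.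
Proof. by apply/matrixP => i j; rewrite !mxE conjCK. Qed.

(** The rows of [P] and of its conjugate span H^1(X, C). *)
Lemma period_matrix_inj g n m (P : 'M[C]_(g, n)) (X : 'M[C]_(n, m)) :
  period_matrix P -> P *m X = 0 -> conjmx P *m X = 0 -> X = 0.
Proof.
move=> Pbij PX cPX.
have PcX : P *m conjmx X = 0.
  by rewrite -[P]conjmxK -map_mxM cPX raddf0.
have toC_eq0 (Y : 'M[R]_(n, m)) : P *m toC Y = 0 -> Y = 0.
  move=> PY; apply/matrixP => i j.
  suff /(congr1 (fun v : 'cV_n => v i 0)) : col j Y = 0 by rewrite !mxE.
  apply: (bij_inj Pbij).
  by rewrite map_col colE mulmxA PY mul0mx map_mx0 mulmx0.
have ReX : map_mx (@complex.Re R) X = 0.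
  apply: toC_eq0.
  have -> : toC (map_mx (@complex.Re R) X) = 2^-1 *: (X + conjmx X).
    by apply/matrixP => i j; rewrite !mxE ReJ_add mulrC.
  by rewrite -scalemxAr mulmxDr PX PcX addr0 scaler0.
have ImX : map_mx (@complex.Im R) X = 0.
  apply: toC_eq0.
  have -> : toC (map_mx (@complex.Im R) X) =
      ('i / 2) *: (conjmx X - X).
    apply/matrixP => i j; rewrite !mxE ImJ_sub -mulrA mulrC.
    by congr (_ * _); rewrite mulrC.
  by rewrite -scalemxAr mulmxBr PX PcX subrr scaler0.
apply/matrixP => i j; rewrite [X i j]complexE.
have /matrixP/(_ i j) := ReX; have /matrixP/(_ i j) := ImX.
by rewrite !mxE => -> ->; rewrite mulr0 addr0.
Qed.

Lemma hodge_circle_unit g n (P : 'M[C]_(g, n)) h :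
  period_matrix P -> hodge_circle P h -> h \in unitmx.
Proof.
move=> Pbij [z [z1 Ph cPh]]; rewrite -unitmx_tr -row_free_unit -kermx_eq0.
have z0 : z != 0 by rewrite -normr_gt0 z1 ltr01.
apply/eqP/trmx_inj; rewrite trmx0; set X := (kermx _)^T.
have hX : h *m X = 0 by rewrite -[h]trmxK -trmx_mul mulmx_ker trmx0.
apply: (period_matrix_inj Pbij).
  by apply: (scalerI z0); rewrite scalemxAl -Ph -mulmxA hX mulmx0 scaler0.
have zc0 : z^* != 0 by rewrite conjC_eq0.
by apply: (scalerI zc0); rewrite scalemxAl -cPh -mulmxA hX mulmx0 scaler0.
Qed.

(** Endomorphisms of X are morphisms of Hodge structures. *)
Lemma EndQ_hodge_circle g n (P : 'M[C]_(g, n)) M h :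
  period_matrix P -> EndQ P M -> hodge_circle P h ->
  h *m ratC M = ratC M *m h.
Proof.
move=> Pbij [T TP] [z [_ Ph cPh]]; apply/eqP; rewrite -subr_eq0; apply/eqP.
have cTP : conjmx T *m conjmx P = conjmx P *m ratC M.
  by rewrite -map_mxM TP map_mxM conjmx_ratC.
apply: (period_matrix_inj Pbij); apply/eqP; rewrite mulmxBr subr_eq0 !mulmxA.
  by rewrite Ph -TP -mulmxA Ph -scalemxAl -TP scalemxAr.
by rewrite cPh -cTP -mulmxA cPh -scalemxAl -cTP scalemxAr.
Qed.

(** Forms of type (1,1), alternating or not, are invariant under h(z), which
    multiplies them by z times its conjugate. *)
Lemma form11_hodge_circle g n (P : 'M[C]_(g, n)) (Y Z : 'M_g) F h :
  F = P^T *m Y *m conjmx P - (P^T *m Z *m conjmx P)^T ->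
  hodge_circle P h -> h^T *m F *m h = F.
Proof.
move=> -> [z [z1 Ph cPh]].
have zz : z * z^* = 1 by rewrite -normCK z1 expr1n.
have inv (W : 'M_g) : h^T *m (P^T *m W *m conjmx P) *m h = P^T *m W *m conjmx P.
  rewrite !mulmxA -trmx_mul Ph -!mulmxA cPh linearZ /= -!scalemxAr -scalemxAl.
  by rewrite scalerA mulrC zz scale1r.
rewrite mulmxBr mulmxBl inv; congr (_ - _).
by rewrite -{2}(inv Z) !trmx_mul !trmxK !mulmxA.
Qed.

(** Two forms invariant under [h] differ by a matrix that commutes with [h]. *)
Lemma isometry_comm (n : nat) (E F h : 'M[C]_n) :
  E \in unitmx -> h \in unitmx ->
  h^T *m E *m h = E -> h^T *m F *m h = F ->
  h *m (invmx E *m F) = invmx E *m F *m h.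
Proof.
move=> EU hU hE hF.
have hTU : h^T \in unitmx by rewrite unitmx_tr.
apply: (can_inj (mulKmx EU)); apply: (can_inj (mulKmx hTU)).
by rewrite !mulmxA hE mulmxV // mul1mx mulmxK // hF.
Qed.

Lemma polarization_unit g n (P : 'M[C]_(g, n)) E :
  period_matrix P -> polarization P E -> E \in unitmx.
Proof.
move=> Pbij [_ Epos]; rewrite -row_free_unit -kermx_eq0.
apply/eqP/row_matrixP => i; rewrite row0.
set r := row i _; apply/eqP/negPn/negP => r0.
have rE : r *m E = 0 by rewrite /r -row_mul mulmx_ker row0.
have [f fK Kf] := Pbij.
pose x : 'cV[R]_n := (map_mx ratr r)^T.
have x0 : x != 0 by rewrite trmx_eq0 map_mx_eq0.
have := Epos x (f ('i *: (P *m toC x))) x0 (Kf _).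
by rewrite trmxK -map_mxM rE map_mx0 mul0mx mxE ltxx.
Qed.

Lemma alternating_sq0 (n : nat) (E : 'M[rat]_n) (v : 'cV_n) :
  E^T = - E -> v^T *m E *m v = 0.
Proof.
move=> ET; apply/matrixP => i j; rewrite !ord1 [RHS]mxE.
have : (v^T *m E *m v)^T 0 0 = - (v^T *m E *m v) 0 0.
  by rewrite !trmx_mul trmxK ET mulmxA mulmxN mulNmx mxE.
by rewrite mxE => /eqP; rewrite -addr_eq0 -mulr2n mulrn_eq0 /= => /eqP.
Qed.

(** The transvections x |-> x + E(v, x) v, for rational v. *)
Lemma transvection_symplectic (n : nat) (E : 'M[rat]_n) (v : 'cV_n) :
  E^T = - E -> symplectic_group E (ratC (1%:M + v *m v^T *m E) : 'M[C]_n).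
Proof.
move=> ET; have vEv := alternating_sq0 v ET.
pose N := v *m v^T *m E.
have NN : N *m N = 0.
  rewrite /N -!mulmxA (mulmxA E) (mulmxA v^T) (mulmxA v^T E).
  by rewrite vEv mul0mx !mulmx0.
split.
  suff /mulmx1_unit[NU _] : (1%:M + N) *m (1%:M - N) = 1%:M.
    by rewrite map_unitmx.
  by rewrite mulmxBr mulmxDl mul1mx mulmx1 mulmxDl mul1mx NN addr0 addrK.
rewrite map_trmx -!map_mxM; congr map_mx; rewrite -/N.
have NTE : N^T *m E = - (E *m N).
  by rewrite /N !trmx_mul trmxK ET !mulNmx !mulmxA.
rewrite [(_ + _)^T]linearD /= trmx1 mulmxDl mul1mx NTE mulmxDr mulmx1.
by rewrite mulmxDl mulNmx -mulmxA NN mulmx0 oppr0 addr0 subrK.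
Qed.

Lemma symplectic_centralizer_scalar (n : nat) (E M : 'M[rat]_n) :
  E^T = - E -> E \in unitmx ->
  (forall g : 'M[C]_n, symplectic_group E g -> g *m ratC M = ratC M *m g) ->
  exists c, M = c%:M.
Proof.
move=> ET EU gM; apply: eigen_all_scalar_mx => v.
have [->|v0] := eqVneq v 0; first by exists 0; rewrite mulmx0 scaler0.
have := gM _ (transvection_symplectic v ET).
rewrite -!map_mxM => /map_mx_inj.
rewrite mulmxDl mulmxDr mul1mx mulmx1 => /addrI vM.
(* [v] is not isotropic for the standard scalar product, so multiplying by
   [v] on the right recovers a multiple of [M *m v] *)
have vv0 : (v^T *m v) 0 0 != 0.
  rewrite mxE; under eq_bigr do rewrite mxE -expr2.
  apply: contraNneq v0 => /psumr_eq0P vv.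
  apply/eqP/matrixP => i j; rewrite ord1 [RHS]mxE; apply/eqP.
  by rewrite -sqrf_eq0 vv // => k _; rewrite sqr_ge0.
exists ((v^T *m E *m M *m (invmx E *m v)) 0 0 / (v^T *m v) 0 0).
apply: (scalerI vv0); rewrite scalerA mulrC divfK //.
have vME := congr1 (mulmx^~ (invmx E *m v)) vM.
rewrite /= !mulmxA mulmxK // -[_ *m v^T *m v]mulmxA in vME.
rewrite [v^T *m v]mx11_scalar mul_mx_scalar in vME.
by rewrite -vME !mulmxA -!(mulmxA v) -mul_mx_scalar -mx11_scalar.
Qed.

(** Commuting with the Hodge circle is commuting with the Hodge group, as the
    centralizer is one of the groups that define it. *)
Lemma hodge_centralizer_scalar g n (P : 'M[C]_(g, n)) (E M : 'M[rat]_n) :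
  period_matrix P -> polarization P E -> hodge_group P = symplectic_group E ->
  (forall h, hodge_circle P h -> h *m ratC M = ratC M *m h) ->
  exists c, M = c%:M.
Proof.
move=> Pbij Epol hodgeE hM; have EU := polarization_unit Pbij Epol.
have [[ET _] _] := Epol.
apply: (symplectic_centralizer_scalar ET EU) => h.
move=> Eh; have : hodge_group P h by rewrite hodgeE.
move=> /(_ _ (centralizer_Q_algebraic M))[] // h' Hh' /=.
by split; [apply: hodge_circle_unit Hh' | apply: hM].
Qed.

Lemma general_EndQ_scalar g n (P : 'M[C]_(g, n)) (E M : 'M[rat]_n) :
  period_matrix P -> polarization P E -> hodge_group P = symplectic_group E ->
  EndQ P M -> exists c, M = c%:M.
Proof.
move=> Pbij Epol hodgeE MP; apply: (hodge_centralizer_scalar Pbij Epol hodgeE).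
by move=> h; apply: EndQ_hodge_circle.
Qed.

(** [F] is any rational bilinear form of type (1,1): [Y] and [Z] are
    independent because [F] is not assumed alternating, which an off-diagonal
    block of a form on a product need not be. *)
Lemma general_form11_scalar g n (P : 'M[C]_(g, n)) (E F : 'M[rat]_n)
    (Y Z : 'M_g) :
  period_matrix P -> polarization P E -> hodge_group P = symplectic_group E ->
  ratC F = P^T *m Y *m conjmx P - (P^T *m Z *m conjmx P)^T ->
  exists c, F = c *: E.
Proof.
move=> Pbij Epol hodgeE FP; have EU := polarization_unit Pbij Epol.
have [[_ [W EP]] _] := Epol.
suff [c Ec] : exists c, invmx E *m F = c%:M.
  by exists c; rewrite -mul_mx_scalar -Ec mulKVmx.
apply: (hodge_centralizer_scalar Pbij Epol hodgeE) => h Ph.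
rewrite map_mxM map_invmx; apply: isometry_comm.
- by rewrite map_unitmx.
- exact: hodge_circle_unit Ph.
- exact: form11_hodge_circle EP Ph.
- exact: form11_hodge_circle FP Ph.
Qed.

(** * The square of a complex torus *)

Lemma EndQ_product g n (P : 'M[C]_(g, n)) (M : 'M[rat]_(n + n)) :
  EndQ (product_period P P) M ->
  [/\ EndQ P (ulsubmx M), EndQ P (ursubmx M), EndQ P (dlsubmx M)
    & EndQ P (drsubmx M)].
Proof.
move=> [T]; rewrite /analytic_rep -[T]submxK -{1}[M]submxK map_block_mx.
rewrite !mulmx_block !(mulmx0, mul0mx, addr0, add0r).
move=> /eq_block_mx[Tul Tur Tdl Tdr].
by split; [exists (ulsubmx T) | exists (ursubmx T) | exists (dlsubmx T)
  | exists (drsubmx T)].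
Qed.

Lemma H11_product g n (P : 'M[C]_(g, n)) (F : 'M[C]_(n + n)) :
  H11 (product_period P P) F ->
  (exists Y Z, ulsubmx F = P^T *m Y *m conjmx P - (P^T *m Z *m conjmx P)^T) /\
  (exists Y Z, ursubmx F = P^T *m Y *m conjmx P - (P^T *m Z *m conjmx P)^T).
Proof.
move=> [Y ->]; rewrite -[Y]submxK /product_period tr_block_mx map_block_mx.
rewrite !map_mx0 !trmx0 !mulmx_block !(mulmx0, mul0mx, addr0, add0r).
rewrite tr_block_mx opp_block_mx add_block_mx block_mxKul block_mxKur.
by split; do 2!eexists.
Qed.

(** A polarization of X^2 is positive, hence nonzero, on the first factor. *)
Lemma polarization_product_neq0 g n (P : 'M[C]_(g, n.+1))
    (F : 'M[rat]_(n.+1 + n.+1)) :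
  period_matrix P -> polarization (product_period P P) F -> ulsubmx F != 0.
Proof.
move=> Pbij [_ Fpos]; apply/eqP => F0; have [f fK Kf] := Pbij.
pose x : 'cV[R]_n.+1 := delta_mx 0 0.
have x0 : x != 0.
  by apply/eqP => /matrixP/(_ 0 0)/eqP; rewrite !mxE !eqxx oner_eq0.
have := Fpos (col_mx x 0) (col_mx (f ('i *: (P *m toC x))) 0).
rewrite col_mx_eq0 negb_and x0 /product_period !map_col_mx !map_mx0.
rewrite !mul_block_col !mulmx0 !mul0mx !addr0 Kf scale_col_mx scaler0.
move=> /(_ isT erefl).
rewrite tr_col_mx trmx0 -[F]submxK F0 map_block_mx map_mx0 mul_row_block.
by rewrite !mul0mx mulmx0 !addr0 mul_row_col mul0mx mulmx0 addr0 mxE ltxx.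
Qed.
End HodgeTheory.

(** * Imaginary quadratic fields *)

Lemma sqr_lt0_conj (C : numClosedFieldType) (z : C) (d : nat) :
  z ^+ 2 = - d%:R -> z^* = - z.
Proof.
move=> z2; have [->|z0] := eqVneq z 0; first by rewrite conjC0 oppr0.
apply: (mulfI z0); rewrite -normCK -normrX z2 normrN normr_nat.
by rewrite mulrN -expr2 z2 opprK.
Qed.

Lemma imaginary_quadratic_notin_rat (K : fieldExtType rat) d (s : K) q :
  imaginary_quadratic d s -> s != q%:A.
Proof.
move=> [d0 _ s2]; apply: contra_eqN s2 => /eqP ->.
rewrite exprZn expr1n -subr_eq0 opprK -scaler_nat -scalerDl scaler_eq0.
by rewrite oner_eq0 orbF gt_eqF // ltr_wpDl ?sqr_ge0 // ltr0n.
Qed.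

Lemma imaginary_quadratic_coord (K : fieldExtType rat) d (s k : K) :
  imaginary_quadratic d s -> exists a b : rat, k = a%:A + b *: s.
Proof.
move=> hK; have [d0 dimK s2] := hK.
have fr : free [:: s; 1].
  rewrite free_cons seq1_free oner_eq0 andbT span_seq1.
  apply/vlineP => -[q sq]; have := imaginary_quadratic_notin_rat q hK.
  by rewrite sq eqxx.
have /eqP spanK : <<[:: s; 1%R]>>%VS == {:K}%VS.
  by rewrite eqEdim subvf dimK (eqP fr).
have : k \in <<[:: s; 1%R]>>%VS by rewrite spanK memvf.
rewrite span_cons span_seq1 => /memv_addP[_ /vlineP[b ->] [_ /vlineP[a ->] ->]].
by exists a, b; rewrite addrC.
Qed.

Section Hermitian.
Variables (R : realType) (K : fieldExtType rat) (e : {rmorphism K -> R[i]}).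
Variables (d : nat) (s : K) (hK : imaginary_quadratic d s).
Local Notation C := R[i].

Lemma ratr_alg a : ratr a = a%:A :> K.
Proof. by rewrite -(fmorph_eq_rat (in_alg K)). Qed.

Lemma rmorph_alg a : e a%:A = ratr a.
Proof. exact: (fmorph_eq_rat (e \o in_alg K)). Qed.

Lemma rmorph_coord a b : e (a%:A + b *: s) = ratr a + ratr b * e s.
Proof. by rewrite -[b *: s]mulr_algl rmorphD rmorphM !rmorph_alg. Qed.

Lemma conj_sqrt : (e s)^* = - e s.
Proof.
have [_ _ s2] := hK; apply: (@sqr_lt0_conj _ _ d).
by rewrite -rmorphXn s2 rmorphN rmorph_nat.
Qed.

Lemma conj_coord a b : (e (a%:A + b *: s))^* = ratr a - ratr b * e s.
Proof.
rewrite rmorph_coord rmorphD; congr (_ + _); first exact: conj_ratr.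
by rewrite rmorphM -mulrN; congr (_ * _); [apply: conj_ratr | apply: conj_sqrt].
Qed.

Lemma Nm_eq0 k : (Nm e k == 0) = (k == 0).
Proof. by rewrite mulf_eq0 conjC_eq0 orbb fmorph_eq0. Qed.

Lemma NmM k l : Nm e (k * l) = Nm e k * Nm e l.
Proof. by rewrite /Nm !rmorphM mulrACA. Qed.

Lemma NmV k : Nm e k^-1 = (Nm e k)^-1.
Proof. by rewrite /Nm !fmorphV invfM. Qed.

Lemma Nm_ratr q : Nm e (ratr q) = ratr (q ^+ 2).
Proof. by rewrite /Nm ratr_alg rmorph_alg conj_ratr -rmorphM. Qed.

Lemma Nm_sqrt : Nm e s = d%:R.
Proof.
have [_ _ s2] := hK; rewrite /Nm conj_sqrt mulrN -rmorphM -expr2 s2.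
by rewrite rmorphN opprK rmorph_nat.
Qed.

Lemma Nm_rational k : exists r : rat, ratr r = Nm e k.
Proof.
have [a [b ->]] := imaginary_quadratic_coord k hK; have [_ _ s2] := hK.
exists (a ^+ 2 + b ^+ 2 * d%:R).
have e2 : e s * e s = - d%:R by rewrite -rmorphM -expr2 s2 rmorphN rmorph_nat.
rewrite /Nm conj_coord rmorph_coord.
rewrite rmorphD rmorphM !rmorphXn rmorph_nat /=.
have -> : d%:R = - (e s * e s) by rewrite e2 opprK.
ring.
Qed.

(** * The Hermitian form of a K-vector space *)

Section Form.
Variables (n : nat) (iota : {rmorphism K -> 'M[rat]_n}) (E : 'M[rat]_n).
Hypothesis E_s : (iota s)^T *m E *m iota s = d%:R *: E.

Lemma rmorph_scalar_mx a : iota a%:A = a%:M.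
Proof.
have -> : iota a%:A = a *: iota 1 by exact: (rat_linear (raddfB iota)).
have -> : iota 1 = 1%:M by exact: rmorph1.
by rewrite scale_scalar_mx mulr1.
Qed.

(* The Hermitian form is compared with complex conjugation through [e]. *)
Local Notation eH x y := (e (Defs.hermitian iota E s x y)).

Lemma bilin_sumr (I : Type) (r : seq I) x (F : I -> 'cV_n) :
  bilin E x (\sum_(i <- r) F i) = \sum_(i <- r) bilin E x (F i).
Proof. by rewrite /bilin mulmx_sumr summxE. Qed.

Lemma bilin_suml (I : Type) (r : seq I) y (F : I -> 'cV_n) :
  bilin E (\sum_(i <- r) F i) y = \sum_(i <- r) bilin E (F i) y.
Proof. by rewrite /bilin raddf_sum /= !mulmx_suml summxE. Qed.

Lemma bilinDr x y z : bilin E x (y + z) = bilin E x y + bilin E x z.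
Proof. by rewrite /bilin mulmxDr mxE. Qed.

Lemma bilinDl x y z : bilin E (x + y) z = bilin E x z + bilin E y z.
Proof. by rewrite /bilin linearD /= !mulmxDl mxE. Qed.

Lemma bilinZr a x y : bilin E x (a *: y) = a * bilin E x y.
Proof. by rewrite /bilin -scalemxAr mxE. Qed.

Lemma bilinZl a x y : bilin E (a *: x) y = a * bilin E x y.
Proof. by rewrite /bilin linearZ /= -!scalemxAl mxE. Qed.

Lemma hermitianE x y :
  eH x y = ratr (bilin E x (iota s *m y)) + e s * ratr (bilin E x y).
Proof. by rewrite /Defs.hermitian !ratr_alg mulr_algr rmorph_coord mulrC. Qed.

Lemma sqrt_mulmx (x : 'cV_n) : iota s *m (iota s *m x) = - d%:R *: x.
Proof.
have [_ _ s2] := hK.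
have -> : iota s *m (iota s *m x) = iota (s ^+ 2) *m x.
  by rewrite rmorphXn mulmxA.
have -> : s ^+ 2 = (- d%:R)%:A by rewrite s2 scaleNr scaler_nat.
by rewrite rmorph_scalar_mx mul_scalar_mx.
Qed.

Lemma coord_mulmx a b (x : 'cV_n) :
  iota (a%:A + b *: s) *m x = a *: x + b *: (iota s *m x).
Proof.
rewrite rmorphD -[b *: s]mulr_algl rmorphM mulmxDl !rmorph_scalar_mx.
by rewrite mul_scalar_mx -mulmxA mul_scalar_mx.
Qed.

Lemma bilin_sqrt x y :
  bilin E (iota s *m x) (iota s *m y) = d%:R * bilin E x y.
Proof.
rewrite /bilin trmx_mul !mulmxA -2!(mulmxA x^T) E_s -scalemxAr -scalemxAl.
by rewrite mxE.
Qed.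

(** The adjoint of s is its conjugate. *)
Lemma bilin_sqrtl x y : bilin E (iota s *m x) y = - bilin E x (iota s *m y).
Proof.
have [d0 _ _] := hK; have dn0 : d%:R != 0 :> rat by rewrite pnatr_eq0 -lt0n.
have := bilin_sqrt x (iota s *m y); rewrite sqrt_mulmx bilinZr mulNr => sxy.
by apply: (mulfI dn0); rewrite mulrN -sxy opprK.
Qed.

Lemma hermitianZr k x y : eH x (iota k *m y) = e k * eH x y.
Proof.
have [_ _ s2] := hK.
have [a [b ->]] := imaginary_quadratic_coord k hK.
have e2 : d%:R = - (e s * e s) :> C.
  by rewrite -rmorphM -expr2 s2 rmorphN opprK rmorph_nat.
rewrite rmorph_coord !hermitianE !coord_mulmx !mulmxDr -!scalemxAr sqrt_mulmx.
rewrite !bilinDr !bilinZr !(rmorphD, rmorphM, rmorphN, rmorph_nat) /=.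
rewrite e2; ring.
Qed.

Lemma hermitianZl k x y : eH (iota k *m x) y = (e k)^* * eH x y.
Proof.
have [_ _ s2] := hK.
have [a [b ->]] := imaginary_quadratic_coord k hK.
have e2 : d%:R = - (e s * e s) :> C.
  by rewrite -rmorphM -expr2 s2 rmorphN opprK rmorph_nat.
rewrite conj_coord !hermitianE !coord_mulmx !bilinDl !bilinZl.
rewrite bilin_sqrt bilin_sqrtl !(rmorphD, rmorphM, rmorphN, rmorph_nat) /=.
rewrite e2; ring.
Qed.

Lemma hermitian_sumr (I : Type) (r : seq I) x (F : I -> 'cV_n) :
  eH x (\sum_(i <- r) F i) = \sum_(i <- r) eH x (F i).
Proof.
under [RHS]eq_bigr do rewrite hermitianE.
by rewrite hermitianE mulmx_sumr !bilin_sumr !rmorph_sum mulr_sumr big_split.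
Qed.

Lemma hermitian_suml (I : Type) (r : seq I) y (F : I -> 'cV_n) :
  eH (\sum_(i <- r) F i) y = \sum_(i <- r) eH (F i) y.
Proof.
under [RHS]eq_bigr do rewrite hermitianE.
by rewrite hermitianE !bilin_suml !rmorph_sum mulr_sumr big_split.
Qed.

(** The determinants of the Hermitian form in two K-bases, whose sizes are not
    assumed equal, differ by the norm of the determinant of the change of
    basis. *)
Lemma hermitian_matrix_change (m m' : nat) (b : 'I_m -> 'cV_n)
    (b' : 'I_m' -> 'cV_n) : K_basis iota b -> K_basis iota b' ->
  exists2 u : K, u != 0 & e (\det (Defs.hermitian_matrix iota E s b')) =
    Nm e u * e (\det (Defs.hermitian_matrix iota E s b)).
Proof.
pose phi (p : nat) (c : 'I_p -> 'cV_n) (x : 'rV[K]_p) :=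
  \sum_j iota (x 0 j) *m c j.
move=> b_bij b'_bij; have [f fK Kf] : bijective (phi m b) := b_bij.
have [f' f'K Kf'] : bijective (phi m' b') := b'_bij.
pose U : 'M[K]_(m', m) := \matrix_i f (b' i).
have phi_row i : phi m b (row i U) = b' i by rewrite rowK Kf.
have phiU c : phi m' b' c = phi m b (c *m U).
  rewrite /phi; under eq_bigr => i _ do rewrite -phi_row mulmx_sumr.
  rewrite exchange_big; apply: eq_bigr => j _ /=.
  rewrite mxE rmorph_sum mulmx_suml; apply: eq_bigr => i _.
  by rewrite mxE rmorphM mulmxA.
have Ufree : row_free U.
  rewrite -kermx_eq0; apply/eqP/row_matrixP => i; rewrite row0.
  apply: (bij_inj b'_bij); rewrite -!/(phi _ _ _) !phiU -row_mul mulmx_ker row0.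
  by rewrite mul0mx.
have Ufull : row_full U.
  apply/row_fullP; exists (\matrix_i f' (phi m b (row i 1%:M))).
  apply/row_matrixP => i; rewrite row_mul rowK; apply: (bij_inj b_bij).
  by rewrite -!/(phi _ _ _) -phiU Kf'.
have mm' : m' = m by rewrite -(eqP Ufree) (eqP Ufull).
subst m'; exists (\det U).
  by rewrite -unitfE -[_ \in _]/(U \in unitmx) -row_free_unit.
have -> : Nm e (\det U) =
    \det (map_mx Num.conj (map_mx e U)) * \det (map_mx e U)^T.
  by rewrite det_tr !det_map_mx mulrC.
rewrite -!det_map_mx mulrAC -!det_mulmx; congr (\det _).
apply/matrixP => i j; rewrite !mxE -!phi_row hermitian_suml.
under eq_bigr => k _ do rewrite hermitianZl hermitian_sumr mulr_sumr.
rewrite exchange_big; apply: eq_bigr => l _ /=.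
rewrite !mxE mulr_suml; apply: eq_bigr => k _.
by rewrite hermitianZr !mxE; ring.
Qed.

(** If the determinant in one basis is a nonzero rational square, the
    discriminant is trivial. *)
Lemma discriminant_sqr (m : nat) (b : 'I_m -> 'cV_n) (q : rat) :
  K_basis iota b -> q != 0 ->
  \det (Defs.hermitian_matrix iota E s b) = ratr (q ^+ 2) ->
  discriminant e iota E s = NmK e.
Proof.
move=> b_bij q0 detb; have ratrI : injective (@ratr C) := fmorph_inj _.
have ratr0 : ratr q != 0 :> K by rewrite ratr_alg scaler_eq0 oner_eq0 orbF.
apply/seteqP; split=> p /=.
- move=> [p0 /(_ m b b_bij)[r [k k0 rk]]]; rewrite detb => pr.
  exists (ratr q / k); first by rewrite mulf_neq0 ?invr_eq0.
  have qpr : q ^+ 2 = p * r by apply: ratrI; rewrite -!rmorph_alg -!ratr_alg pr.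
  by rewrite NmM NmV Nm_ratr -rk qpr rmorphM mulfK //=; rewrite rk Nm_eq0.
- move=> [k k0 pk]; have p0 : p != 0.
    have : ratr p != 0 :> C by rewrite pk Nm_eq0.
    by apply: contraNneq => ->; rewrite rmorph0.
  split=> // m' b' b'_bij.
  have [u u0 detb'] := hermitian_matrix_change b_bij b'_bij.
  have [r rE] := Nm_rational (ratr q * u / k).
  exists r.
    exists (ratr q * u / k) => //.
    by rewrite mulf_neq0 ?invr_eq0 // (mulf_neq0 ratr0).
  apply: (fmorph_inj e); rewrite detb' detb !ratr_alg !rmorph_alg.
  rewrite [ratr (p * r)]rmorphM /= rE.
  rewrite NmM NmV (NmM (ratr q)) Nm_ratr -pk [LHS]mulrC [RHS]mulrC divfK //.
  by rewrite pk Nm_eq0.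
Qed.
End Form.
End Hermitian.

(** * K acting on the square of a rational vector space *)

Section Block.
Variables (K : fieldExtType rat) (d : nat) (s : K).
Variable hK : imaginary_quadratic d s.
Variables (n : nat) (iota : {rmorphism K -> 'M[rat]_(n + n)}).
(* The standard basis of the first factor. *)
Local Notation b0 :=
  (fun j : 'I_n => col_mx (delta_mx j 0) 0 : 'cV[rat]_(n + n)).

Lemma block_mulmx_col p r (u : 'cV[rat]_n) :
  ulsubmx (iota s) = p%:M -> dlsubmx (iota s) = r%:M ->
  iota s *m col_mx u 0 = col_mx (p *: u) (r *: u).
Proof.
move=> sul sdl; rewrite -[iota s]submxK sul sdl mul_block_col !mulmx0 !addr0.
by rewrite !mul_scalar_mx.
Qed.

(** Otherwise [p] would be a rational square root of -d. *)
Lemma block_sqrt_neq0 p r (u : 'cV[rat]_n) : u != 0 ->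
  ulsubmx (iota s) = p%:M -> dlsubmx (iota s) = r%:M -> r != 0.
Proof.
move=> u0 sul sdl; apply/eqP => r0; have [d0 _ _] := hK.
have su := block_mulmx_col u sul sdl; rewrite r0 scale0r in su.
have := sqrt_mulmx hK iota (col_mx u 0).
rewrite su (block_mulmx_col _ sul sdl) r0 scale0r scale_col_mx.
move=> /eq_col_mx[/eqP].
rewrite scalerA -subr_eq0 -scalerBl scaler_eq0 (negPf u0) orbF opprK.
by rewrite gt_eqF // ltr_wpDl -?expr2 ?sqr_ge0 // ltr0n.
Qed.

Lemma block_K_basis p r : r != 0 ->
  ulsubmx (iota s) = p%:M -> dlsubmx (iota s) = r%:M -> K_basis iota b0.
Proof.
move=> r0 sul sdl.
(* the coefficient a + b s contributes (a + b p, b r) to each coordinate; [g]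
   solves these equations for a and b *)
pose f (c : 'rV[K]_n) := \sum_j iota (c 0 j) *m b0 j.
pose g (v : 'cV[rat]_(n + n)) : 'rV[K]_n := \row_j
  ((v (lshift n j) 0 - v (rshift n j) 0 / r * p)%:A
   + (v (rshift n j) 0 / r) *: s).
have fE (c : 'rV[K]_n) j a b : c 0 j = a%:A + b *: s ->
    f c (lshift n j) 0 = a + b * p /\ f c (rshift n j) 0 = b * r.
  have term i a' b' : iota (a'%:A + b' *: s) *m b0 i =
      col_mx ((a' + b' * p) *: delta_mx i 0) ((b' * r) *: delta_mx i 0).
    rewrite coord_mulmx (block_mulmx_col _ sul sdl) !scale_col_mx.
    by rewrite add_col_mx scaler0 add0r !scalerA scalerDl.
  move=> cj; rewrite /f !summxE.
  split; rewrite (bigD1 j) //= big1 => [|i ij].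
  - by rewrite cj term col_mxEu !mxE !eqxx mulr1 addr0.
  - have [a' [b' ->]] := imaginary_quadratic_coord (c 0 i) hK.
    by rewrite term col_mxEu !mxE [j == i]eq_sym (negPf ij) mulr0.
  - by rewrite cj term col_mxEd !mxE !eqxx mulr1 addr0.
  - have [a' [b' ->]] := imaginary_quadratic_coord (c 0 i) hK.
    by rewrite term col_mxEd !mxE [j == i]eq_sym (negPf ij) mulr0.
exists g => [c|v].
  apply/rowP => j; rewrite mxE.
  have [a [b cj]] := imaginary_quadratic_coord (c 0 j) hK.
  have [-> ->] := fE c j a b cj.
  by rewrite mulfK // addrK cj.
apply/colP => k; rewrite -[k]splitK; case: (split k) => j /=.
all: have [fl fr] := fE (g v) j _ _ (mxE _ _ _ _).
  by rewrite fl subrK.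
by rewrite fr divfK.
Qed.

Lemma bilin_block (F : 'M[rat]_(n + n)) i j :
  bilin F (b0 i) (b0 j) = ulsubmx F i j.
Proof.
rewrite /bilin -[F in LHS]submxK tr_col_mx trmx0 mul_row_block !mul0mx !addr0.
rewrite mul_row_col mulmx0 addr0 trmx_delta -rowE -colE.
by rewrite !mxE.
Qed.

Lemma sqrt_form_sym (F : 'M[rat]_(n + n)) :
  F^T = - F -> (iota s)^T *m F *m iota s = d%:R *: F ->
  (F *m iota s)^T = F *m iota s.
Proof.
move=> FT Fs; have [d0 _ s2] := hK.
have dn0 : d%:R != 0 :> rat by rewrite pnatr_eq0 -lt0n.
rewrite trmx_mul FT mulmxN; apply: (scalerI dn0).
rewrite [RHS]scalemxAl -Fs -(mulmxA _ (iota s)).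
have -> : iota s *m iota s = (- d%:R)%:M.
  rewrite -[_ *m _]/(iota s * iota s) -rmorphM -expr2 s2.
  by rewrite -(rmorph_scalar_mx iota) scaleNr scaler_nat.
by rewrite mul_mx_scalar scaleNr scalerN.
Qed.

Lemma hermitian_matrix_block (F : 'M[rat]_(n + n)) (E0 : 'M[rat]_n) p r l m :
  F^T = - F -> E0^T = - E0 -> (iota s)^T *m F *m iota s = d%:R *: F ->
  ulsubmx (iota s) = p%:M -> dlsubmx (iota s) = r%:M ->
  ulsubmx F = l *: E0 -> ursubmx F = m *: E0 ->
  Defs.hermitian_matrix iota F s b0 = s *: map_mx (in_alg K) (l *: E0).
Proof.
move=> FT E0T Fs sul sdl Ful Fur.
(* this block is both symmetric and a multiple of the alternating [E0] *)
have ul0 : ulsubmx (F *m iota s) = 0.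
  have ulE : ulsubmx (F *m iota s) = (l * p + m * r) *: E0.
    rewrite -[F]submxK -[iota s]submxK mulmx_block block_mxKul sul sdl Ful Fur.
    by rewrite !mul_mx_scalar !scalerA scalerDl mulrC [r * _]mulrC.
  have : (ulsubmx (F *m iota s))^T = ulsubmx (F *m iota s).
    by rewrite -{2}(sqrt_form_sym FT Fs) trmx_ulsub.
  rewrite ulE linearZ /= E0T scalerN => /eqP; rewrite eq_sym -addr_eq0 -mulr2n.
  by rewrite -scaler_nat scaler_eq0 pnatr_eq0 /= => /eqP.
apply/matrixP => i j; rewrite !mxE /Defs.hermitian !ratr_alg bilin_block Ful.
have -> : bilin F (b0 i) (iota s *m b0 j) = bilin (F *m iota s) (b0 i) (b0 j).
  by rewrite /bilin !mulmxA.
by rewrite bilin_block ul0 [X in X%:A]mxE scale0r add0r mxE.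
Qed.
End Block.


(** * Triviality of the discriminant *)

Theorem proposition7p1 (R : realType)
    (PJ : 'M[R[i]]_(2, 4)) (hJ : general_abelian_surface PJ)
    (K : fieldExtType rat) (d : nat) (s : K) (hK : imaginary_quadratic d s)
    (e : {rmorphism K -> R[i]})
    (iota : {rmorphism K -> 'M[rat]_(4 + 4)}) (omegaK : 'M[rat]_(4 + 4))
    (hW : polarized_weil_type e (product_period PJ PJ) iota omegaK) :
  discriminant e iota omegaK s = NmK e.
Proof.
have [[Pbij _] [E Epol hodgeE]] := hJ.
have [[_ endA _] wpol wNm] := hW; have [[wT wH] _] := wpol.
have [[ET _] _] := Epol; have EU := polarization_unit Pbij Epol.
have [d0 _ s2] := hK.
have w_s : (iota s)^T *m omegaK *m iota s = d%:R *: omegaK.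
  apply: (@map_mx_inj _ _ (@ratr R[i])).
  by rewrite wNm (Nm_sqrt e hK) map_mxZ rmorph_nat.
have [sul _ sdl _] := EndQ_product (endA s).
have [p {}sul] := general_EndQ_scalar Pbij Epol hodgeE sul.
have [r {}sdl] := general_EndQ_scalar Pbij Epol hodgeE sdl.
have [[Y [Z wul]] [Y' [Z' wur]]] := H11_product wH.
rewrite -map_ulsubmx in wul; rewrite -map_ursubmx in wur.
have [l {}wul] := general_form11_scalar Pbij Epol hodgeE wul.
have [m {}wur] := general_form11_scalar Pbij Epol hodgeE wur.
have l0 : l != 0.
  have := polarization_product_neq0 Pbij wpol; rewrite wul.
  by apply: contraNneq => ->; rewrite scale0r.
have r0 : r != 0.
  apply: (block_sqrt_neq0 hK (u := delta_mx 0 0) _ sul sdl).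
  by apply/eqP => /matrixP/(_ 0 0); rewrite !mxE.
have Eii i : E i i = 0.
  have /matrixP/(_ i i) := ET; rewrite !mxE => /eqP.
  by rewrite -addr_eq0 -mulr2n mulrn_eq0 => /eqP.
have [q detE] := det_alternating4 Eii ET.
have q0 : q != 0.
  by move: EU; rewrite unitmxE unitfE detE sqrf_eq0.
apply: (@discriminant_sqr _ _ e _ _ hK _ _ _ w_s 4 _ (d%:R * l ^+ 2 * q)).
- exact: (block_K_basis hK r0 sul sdl).
- by rewrite !mulf_neq0 ?expf_neq0 // pnatr_eq0 -lt0n.
rewrite (hermitian_matrix_block hK wT ET w_s sul sdl wul wur).
have s4 : s ^+ 4 = (d%:R ^+ 2 : rat)%:A.
  by rewrite -[4%N]/(2 * 2)%N exprM s2 sqrrN -(rmorph_nat (in_alg K)) -rmorphXn.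
rewrite detZ det_map_mx detZ detE s4 ratr_alg mulr_algl /= scalerA.
by congr (_%:A); ring.
Qed.
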